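(* Let $n,k\ge 1$ be integers, let $\lambda_1,\lambda_2,\ldots,\lambda_{nk}$ be $nk$ distinct real numbers, let $\alpha_{k,1},\ldots,\alpha_{k,n}$ be positive real numbers and, for each $0\le s\le k-1$, let $G_s$ be a simple graph on the vertex set $\{1,2,\ldots,n\}$. Then there is an $n\times n$ real symmetric matrix polynomial $A(z)=\sum_{s=0}^{k}A_s z^s$ (that is, every $A_s\in\mathbb{R}^{n\times n}$ is symmetric) for which: (a) the proper values of $A(z)$ are $\lambda_1,\lambda_2,\ldots,\lambda_{nk}$; (b) the leading coefficient is $A_k=\operatorname{diag}[\alpha_{k,1},\alpha_{k,2},\ldots,\alpha_{k,n}]$; (c) for $s=0,1,\ldots,k-1$, the graph of $A_s$ is $G_s$.
   Context: A proper value of a matrix polynomial $A(z)$ is a zero $z\in\mathbb{C}$ of $\det A(z)$. Graphs are simple (undirected, loopless, without multiple edges) and may have any number of edges, including none. The graph of a real symmetric matrix $B=[b_{ij}]\in\mathbb{R}^{n\times n}$ is the simple graph on vertices $1,\ldots,n$ in which distinct vertices $i\ne j$ are adjacent if and only if $b_{ij}\neq 0$; the diagonal entries play no role. *)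

(* Defs.v *)
From mathcomp Require Import all_boot all_order all_algebra.
From mathcomp Require Import complex reals.

Set Implicit Arguments.
Unset Strict Implicit.
Unset Printing Implicit Defensive.

Import GRing.Theory Num.Theory.
Local Open Scope ring_scope.
Local Open Scope complex_scope.

(* A real matrix polynomial A(z) = sum_(s <= k) A_s z^s of formal degree k is
   represented by its family of coefficients A : 'I_k.+1 -> 'M[R]_n. *)
Definition mxpoly_eval (R : realType) (n k : nat) (A : 'I_k.+1 -> 'M[R]_n)
    (z : R[i]) : 'M[R[i]]_n :=
  \sum_(s < k.+1) z ^+ s *: map_mx (real_complex R) (A s).

Definition proper_value (R : realType) (n k : nat) (A : 'I_k.+1 -> 'M[R]_n)
    (z : R[i]) : Prop :=
  \det (mxpoly_eval A z) = 0.

Definition simple_graph (n : nat) (G : rel 'I_n) : Prop :=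
  symmetric G /\ irreflexive G.

Definition mx_graph (R : realType) (n : nat) (B : 'M[R]_n) : rel 'I_n :=
  fun i j => (i != j) && (B i j != 0).

(* Main.v *)
(** Split the prescribed proper values into [n] groups of [k], [x i 0], ...,
    [x i (k-1)], and start from the diagonal matrix polynomial whose [i]-th entry
    is [alpha i] times the product of the ['X - x i l].  Perturb it by [e] times
    the graph pattern off the diagonal, and by [e * u i l] times the product of
    the ['X - x i m] for [m != l] on the diagonal.  At the node [x q l] the whole
    row [q] is then divisible by [e], and after division the determinant is
    [pivot * u q l + e * H q l (e, u)] with [pivot != 0] and [H] polynomial.
    Requiring all these to vanish is a fixed point equation
    [u q l = - e * H q l (e, u) / pivot], solved on the unit ball by Banach's
    theorem when [e > 0] is small.  The determinant has degree [n * k] and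
    [n * k] distinct real roots, hence no other complex root. *)

Require Import Defs.
From HB Require Import structures.
From mathcomp Require Import all_boot all_order all_algebra.
From mathcomp Require Import complex reals.
From mathcomp Require Import fingroup perm ring lra.
From mathcomp Require Import interval_inference.
From mathcomp Require Import boolp classical_sets functions.
From mathcomp Require Import topology normedtype sequences.

Set Implicit Arguments.
Unset Strict Implicit.
Unset Printing Implicit Defensive.

Import Order.TTheory GRing.Theory Num.Theory.
Import numFieldNormedType.Exports.

Local Open Scope ring_scope.
Local Open Scope complex_scope.

(** * Functions of a small parameter and a vector, to first order in the parameter *)

Section SmallParameter.
Context {R : realType} {V : normedModType R}.
Implicit Types f g : R -> V -> R.

(** The same [C] bounds values and Lipschitz ratios, for [e] in [0, 1] and vectors in the closed
    unit ball. The bound on values is what makes the class stable under products. *)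
Definition unif_lip f := exists2 C : R, 0 <= C &
  forall e u v, 0 <= e <= 1 -> `|u| <= 1 -> `|v| <= 1 ->
    `|f e u| <= C /\ `|f e u - f e v| <= C * `|u - v|.

Lemma unif_lip_cst (c : R -> R) (C : R) :
  (forall e, 0 <= e <= 1 -> `|c e| <= C) -> unif_lip (fun e _ => c e).
Proof.
move=> cC; have C0 : 0 <= C by apply: le_trans (cC 0 _); rewrite ?lexx ?ler01.
exists C => // e u v he hu hv; rewrite subrr normr0 mulr_ge0 //.
by split=> //; exact: cC.
Qed.

Lemma unif_lipD f g :
  unif_lip f -> unif_lip g -> unif_lip (fun e u => f e u + g e u).
Proof.
move=> [C C0 fC] [D D0 gD]; exists (C + D); first exact: addr_ge0.
move=> e u v he hu hv; have [f1 f2] := fC e u v he hu hv.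
have [g1 g2] := gD e u v he hu hv; split.
  by rewrite (le_trans (ler_normD _ _)) // lerD.
rewrite opprD addrACA [leRHS]mulrDl (le_trans (ler_normD _ _)) //.
by rewrite lerD.
Qed.

Lemma unif_lipM f g :
  unif_lip f -> unif_lip g -> unif_lip (fun e u => f e u * g e u).
Proof.
move=> [C C0 fC] [D D0 gD]; exists (C * D + C * D).
  by rewrite addr_ge0 ?mulr_ge0.
move=> e u v he hu hv; have [f1 f2] := fC e u v he hu hv.
have [g1 g2] := gD e u v he hu hv.
have [g3 _] := gD e v v he hv hv.
split.
  rewrite normrM (@le_trans _ _ (C * D)) ?ler_pM //.
  by rewrite lerDl mulr_ge0.
have -> : f e u * g e u - f e v * g e v =
   f e u * (g e u - g e v) + (f e u - f e v) * g e v by ring.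
rewrite [leRHS]mulrDl (le_trans (ler_normD _ _)) // !normrM lerD //.
  by rewrite -mulrA ler_pM.
by rewrite mulrAC ler_pM.
Qed.

(* [f e u = f 0 u + O(e)], the remainder being [e] times a function which is
   Lipschitz in [u] uniformly in [e]. *)
Definition small_pert f := exists h : R -> V -> R,
  [/\ unif_lip h, unif_lip (fun _ => f 0) &
      forall e u, f e u = f 0 u + e * h e u].

Lemma unif_lip0 : unif_lip (fun _ _ => 0).
Proof. by apply: (@unif_lip_cst _ 0) => e _; rewrite normr0. Qed.

Lemma small_pert_lip (f : V -> R) :
  unif_lip (fun _ => f) -> small_pert (fun _ => f).
Proof.
move=> fl; exists (fun _ _ => 0); split=> //; first exact: unif_lip0.
by move=> e u; rewrite mulr0 addr0.
Qed.

Lemma small_pert_cst (c : R) : small_pert (fun _ _ => c).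
Proof. by apply: small_pert_lip; apply: (@unif_lip_cst _ `|c|). Qed.

Lemma small_pert_param : small_pert (fun e _ => e).
Proof.
exists (fun _ _ => 1); split; last by move=> e u; rewrite mulr1 add0r.
  by apply: (@unif_lip_cst _ 1) => e _; rewrite normr1.
exact: unif_lip0.
Qed.

Lemma small_pertD f g :
  small_pert f -> small_pert g -> small_pert (fun e u => f e u + g e u).
Proof.
move=> [f' [lf' lf fE]] [g' [lg' lg gE]].
exists (fun e u => f' e u + g' e u); split; [exact: unif_lipD..|].
by move=> e u; rewrite fE gE; ring.
Qed.

Lemma small_pertM f g :
  small_pert f -> small_pert g -> small_pert (fun e u => f e u * g e u).
Proof.
move=> [f' [lf' lf fE]] [g' [lg' lg gE]].
(* Expanding the product leaves a second-order term; it keeps one factor [e], which is bounded by 1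
   on the range considered. *)
exists (fun e u => f' e u * g 0 u + (f 0 u * g' e u + (e * f' e u) * g' e u)).
split; last by move=> e u; rewrite fE gE; ring.
- apply: unif_lipD; first exact: unif_lipM.
  apply: unif_lipD; first exact: unif_lipM.
  apply: unif_lipM => //; apply: unif_lipM => //.
  by apply: (@unif_lip_cst _ 1) => e /andP[e0 e1]; rewrite ger0_norm.
- exact: unif_lipM.
Qed.

Lemma eq_small_pert f g :
  (forall e u, f e u = g e u) -> small_pert f -> small_pert g.
Proof.
move=> fg [h [lh l0 fE]]; exists h; split=> // [|e u]; last by rewrite -!fg.
by have -> : g = f by apply/funext => e; apply/funext => u.
Qed.

Lemma small_pert_sum (I : Type) (r : seq I) (P : pred I)
    (F : I -> R -> V -> R) :
  (forall i, P i -> small_pert (F i)) ->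
  small_pert (fun e u => \sum_(i <- r | P i) F i e u).
Proof.
move=> FP; elim: r => [|i r IH].
  by apply: eq_small_pert (small_pert_cst 0) => e u; rewrite big_nil.
have [Pi|nPi] := boolP (P i).
  apply: eq_small_pert (small_pertD (FP i Pi) IH) => e u.
  by rewrite big_cons Pi.
by apply: eq_small_pert IH => e u; rewrite big_cons (negbTE nPi).
Qed.

Lemma small_pert_prod (I : Type) (r : seq I) (P : pred I)
    (F : I -> R -> V -> R) :
  (forall i, P i -> small_pert (F i)) ->
  small_pert (fun e u => \prod_(i <- r | P i) F i e u).
Proof.
move=> FP; elim: r => [|i r IH].
  by apply: eq_small_pert (small_pert_cst 1) => e u; rewrite big_nil.
have [Pi|nPi] := boolP (P i).
  apply: eq_small_pert (small_pertM (FP i Pi) IH) => e u.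
  by rewrite big_cons Pi.
by apply: eq_small_pert IH => e u; rewrite big_cons (negbTE nPi).
Qed.

(** By the Leibniz formula, a determinant is a sum of products of entries. *)
Lemma small_pert_det (n : nat) (N : R -> V -> 'M[R]_n) :
  (forall i j, small_pert (fun e u => N e u i j)) ->
  small_pert (fun e u => \det (N e u)).
Proof.
move=> NP; apply: small_pert_sum => s _; apply: small_pertM.
  exact: small_pert_cst.
by apply: small_pert_prod.
Qed.

End SmallParameter.

(** * Fixed points in the space of real matrices *)

HB.instance Definition _ (R : realType) (m n : nat) := Complete.on 'M[R]_(m, n).

Lemma ler_entry_mx_norm (R : realType) (m n : nat) (x : 'M[R]_(m, n)) i j :
  `|x i j| <= `|x|.
Proof.
rewrite [leRHS]/Num.norm /= mx_normrE.
by apply/bigmax_geP; right; exists (i, j).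
Qed.

Lemma mx_norm_ler (R : realType) (m n : nat) (x : 'M[R]_(m, n)) (C : R) :
  0 <= C -> (forall i j, `|x i j| <= C) -> `|x| <= C.
Proof.
by move=> C0 xC; rewrite [leLHS]/Num.norm /= mx_normrE; apply/bigmax_leP; split.
Qed.

Lemma small_pert_entry (R : realType) (m n : nat) i j :
  small_pert (fun (_ : R) (u : 'M[R]_(m, n)) => u i j).
Proof.
apply: small_pert_lip; exists 1 => // e u v _ u1 v1; split.
  exact: le_trans (ler_entry_mx_norm _ _ _) u1.
by rewrite mul1r; have := ler_entry_mx_norm (u - v) i j; rewrite !mxE.
Qed.

(** For small [e] the right-hand side maps the closed unit ball into itself and contracts it, so
    Banach's theorem applies. *)
Lemma small_param_fixpoint (R : realType) (m n : nat)
    (h : 'I_m -> 'I_n -> R -> 'M[R]_(m, n) -> R) :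
  (forall i j, unif_lip (h i j)) ->
  exists2 e : R, 0 < e &
    exists u : 'M[R]_(m, n), forall i j, u i j = e * h i j e u.
Proof.
move=> hl.
have [C C0 hC] : exists2 C : R, 0 <= C & forall i j e u v, 0 <= e <= 1 ->
    `|u| <= 1 -> `|v| <= 1 ->
    `|h i j e u| <= C /\ `|h i j e u - h i j e v| <= C * `|u - v|.
  pose c i j := projT1 (cid2 (hl i j)).
  have cP i j : 0 <= c i j by rewrite /c; case: cid2.
  (* There are finitely many nonnegative constants, so their sum dominates each of them. *)
  exists (\sum_i \sum_j c i j); first by do 2!apply: sumr_ge0 => ? _.
  move=> i j e u v he hu hv.
  have cle : c i j <= \sum_i \sum_j c i j.
    rewrite (bigD1 i) //= (bigD1 j) //= -addrA lerDl.
    by rewrite addr_ge0 ?sumr_ge0 // => k _; rewrite sumr_ge0.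
  have [h1 h2] : `|h i j e u| <= c i j /\
      `|h i j e u - h i j e v| <= c i j * `|u - v|.
    by move: cle; rewrite /c; case: cid2 => /= x x0 hx _; exact: hx.
  split; first exact: le_trans h1 cle.
  by rewrite (le_trans h2) // ler_wpM2r.
(* This choice makes [e * C] at most 1/2, which serves as contraction ratio; the added 1 keeps [e]
   in (0, 1] even when [C = 0]. *)
pose e := (2 * (C + 1))^-1.
have e0 : 0 < e by rewrite invr_gt0 mulr_gt0 // ltr_wpDl.
have eC : e * C <= 2^-1.
  rewrite /e invfM -mulrA ler_piMr ?invr_ge0 //.
  by rewrite mulrC ler_pdivrMr ?ltr_wpDl // mul1r lerDl.
have e1 : 0 <= e <= 1.
  rewrite ltW //= invf_le1 ?mulr_gt0 ?ltr_wpDl //; lra.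
pose U : set 'M[R]_(m, n) := closed_ball (0 : 'M[R]_(m, n)) 1.
have UE u : U u <-> `|u| <= 1.
  by rewrite /U closed_ballE // /closed_ball_ /= sub0r normrN.
pose f (u : 'M[R]_(m, n)) : 'M[R]_(m, n) := \matrix_(i, j) (e * h i j e u).
have fU : set_fun U U f.
  move=> u /UE u1; apply/UE; apply: mx_norm_ler => // i j; rewrite mxE.
  rewrite normrM (gtr0_norm e0); have [h1 _] := hC i j e u u e1 u1 u1.
  rewrite (le_trans (ler_wpM2l (ltW e0) h1)) // (le_trans eC) //.
  by rewrite invf_le1 ?ler1n.
pose ff : {fun U >-> U} := HB.pack f (isFun.Build _ _ _ _ f fU).
exists e => //.
have ctr : is_contraction ff.
  exists (2^-1)%:nng; split; first by rewrite /= invf_lt1 ?ltr1n.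
  move=> [u v] [/= /UE u1 /UE v1].
  apply: mx_norm_ler => [|i j]; first by rewrite mulr_ge0.
  rewrite !mxE -mulrBr normrM (gtr0_norm e0).
  have [_ h2] := hC i j e u v e1 u1 v1.
  rewrite (le_trans (ler_wpM2l (ltW e0) h2)) // mulrA.
  by rewrite ler_wpM2r.
have [] := banach_fixed_point ctr (@closed_ball_closed _ _ _ _).
  by exists 0; apply/UE; rewrite normr0.
move=> u _ uE; exists u => i j.
by rewrite {1}uE /= mxE.
Qed.

(** * Determinants, degrees and roots *)

(** A permutation other than the identity moves some index besides [q], and the corresponding factor
    kills its Leibniz term. *)
Lemma det_diag_but_row (A : comNzRingType) (n : nat) (M : 'M[A]_n) (q : 'I_n) :
  (forall i j, i != q -> i != j -> M i j = 0) -> \det M = \prod_i M i i.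
Proof.
move=> M0; rewrite /determinant (bigD1 1%g) //= [X in _ + X]big1 => [|s s1].
  rewrite odd_perm1 expr0 mul1r addr0.
  by apply: eq_bigr => i _; rewrite perm1.
have [i iq si] : exists2 i, i != q & i != s i.
  apply/exists_inP; apply: contraR s1; rewrite negb_exists_in => /forall_inP sE.
  have sfix i : i != q -> s i = i by move=> /sE; rewrite negbK => /eqP.
  apply/eqP/permP => i; rewrite perm1; have [->|/sfix //] := eqVneq i q.
  (* If [s q] differed from [q], it would be fixed by [s], and injectivity would give [s q = q]. *)
  apply/eqP; apply: contraTT isT => /[dup] /sfix /perm_inj ->.
  by rewrite eqxx.
by rewrite (bigD1 i) //= M0 // mul0r mulr0.
Qed.

(** The identity permutation contributes degree [n * k]; every other one picks an off-diagonal entry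
    and has lower degree. *)
Lemma size_det_diag_dominant (A : idomainType) (n k : nat)
    (M : 'M[{poly A}]_n) :
  (forall i, size (M i i) = k.+1) ->
  (forall i j, i != j -> (size (M i j) <= k)%N) ->
  size (\det M) = (n * k).+1.
Proof.
move=> Md Mo; rewrite /determinant (bigD1 1%g) //= odd_perm1 expr0 mul1r.
have sz1 : size (\prod_i M i ((1%g : {perm 'I_n}) i)) = (n * k).+1.
  rewrite size_prod => [|i _]; last by rewrite perm1 -size_poly_gt0 Md.
  rewrite (eq_bigr (fun=> k.+1)) => [|i _]; last by rewrite perm1 Md.
  by rewrite sum_nat_const card_ord mulnS -addnS addKn.
rewrite size_polyDl ?sz1 // ltnS.
apply: leq_trans (size_sum _ _ _) _; apply/bigmax_leqP => s s1.
rewrite size_Msign; apply: leq_trans (size_poly_prod_leq _ _) _.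
have [i si] : exists i, i != s i.
  apply/existsP; apply: contraR s1; rewrite negb_exists => /forallP sE.
  by apply/eqP/permP => i; rewrite perm1; have := sE i; rewrite negbK => /eqP.
(* The size bound for a product is one more than the sum of the sizes, minus [n]; the factor at [i],
   of size at most [k], absorbs that extra one. *)
rewrite card_ord leq_subLR -mulnS (bigD1 i) //= -addSn.
have le_sz j : (size (M j (s j)) <= k.+1)%N.
  have [<-|/Mo] := eqVneq j (s j); first by rewrite Md.
  by move/leqW.
have -> : (n * k.+1 = k.+1 + \sum_(j < n | j != i) k.+1)%N.
  by rewrite -[in LHS](card_ord n) -sum_nat_const (bigD1 i).
by rewrite leq_add ?ltnS ?Mo // leq_sum.
Qed.

(** Evaluation at [z] and extension of scalars are ring morphisms, hence commute with the
    determinant; the size bound ensures that the coefficients up to [k] recover each entry. *)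
Lemma proper_value_coef (R : realType) (n k : nat) (P : 'M[{poly R}]_n)
    (z : R[i]) :
  (forall i j, (size (P i j) <= k.+1)%N) ->
  proper_value (fun s : 'I_k.+1 => \matrix_(i, j) (P i j)`_s) z <->
  root (map_poly (real_complex R) (\det P)) z.
Proof.
move=> szP; rewrite /proper_value.
suff -> : mxpoly_eval (fun s : 'I_k.+1 => \matrix_(i, j) (P i j)`_s) z =
    map_mx (horner_eval z) (map_mx (map_poly (real_complex R)) P).
  by rewrite !det_map_mx rootE; split=> /eqP.
apply/matrixP => i j; rewrite /mxpoly_eval summxE !mxE /= /horner_eval.
rewrite (@horner_coef_wide _ k.+1) ?size_map_poly //.
by apply: eq_bigr => s _; rewrite !mxE coef_map mulrC.
Qed.

(** A polynomial with as many distinct roots as its degree already splits over [F], so no new root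
    appears in [K]. *)
Lemma root_map_prod (F : fieldType) (K : fieldType) (f : {rmorphism F -> K})
    (p : {poly F}) (rs : seq F) (z : K) :
  size p = (size rs).+1 -> all (root p) rs -> uniq rs ->
  root (map_poly f p) z = (z \in map f rs).
Proof.
move=> szp rtp urs.
have p0 : lead_coef p != 0 by rewrite lead_coef_eq0 -size_poly_gt0 szp.
rewrite (all_roots_prod_XsubC szp rtp) ?uniq_rootsE //.
rewrite map_polyZ rootZ ?fmorph_eq0 // rmorph_prod /=.
rewrite (eq_bigr (fun x => 'X - (f x)%:P)); last first.
  by move=> x _; rewrite map_polyXsubC.
by rewrite -(big_map f predT (fun x => 'X - x%:P)) root_prod_XsubC.
Qed.

(** * Perturbing a diagonal polynomial matrix while keeping its roots *)

Section PrescribedRoots.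
Variables (R : realType) (n k : nat).
Variables (p : 'I_n -> {poly R}) (w : 'I_n -> 'I_k -> {poly R}).
Variables (c : 'I_n -> 'I_n -> {poly R}) (x : 'I_n -> 'I_k -> R).

(** Under the root hypotheses below, only the unknown [u q l] survives in the diagonal entry of row
    [q] at [x q l]: there is one unknown per prescribed root. *)
Definition pert_mx (e : R) (u : 'M[R]_(n, k)) : 'M[{poly R}]_n :=
  \matrix_(i, j) if i == j then p i + e *: \sum_m u i m *: w i m
                 else e *: c i j.

(* [pert_mx e u] at [x q l], with the common factor [e] of row [q] removed. *)
Definition reduced_mx q l (e : R) (u : 'M[R]_(n, k)) : 'M[R]_n :=
  \matrix_(i, j)
    if i == q then
      if j == q then u q l * (w q l).[x q l] else (c q j).[x q l]
    else if i == j then (p i).[x q l] + e * \sum_m u i m * (w i m).[x q l]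
    else e * (c i j).[x q l].

Hypothesis p_root : forall q l, (p q).[x q l] = 0.
Hypothesis w_root : forall q l m, m != l -> (w q m).[x q l] = 0.

Lemma horner_pert_mx q l e u :
  map_mx (horner_eval (x q l)) (pert_mx e u) =
  diag_mx (\row_i if i == q then e else 1) *m reduced_mx q l e u.
Proof.
apply/matrixP => i j; rewrite mul_diag_mx !mxE /horner_eval.
have [->|iq] := eqVneq i q; last first.
  rewrite mul1r; case: eqP => _; rewrite !hornerE //.
  congr (_ + _ * _); rewrite horner_sum.
  by apply: eq_bigr => m _; rewrite hornerZ.
rewrite eq_sym; case: eqP => _; last by rewrite hornerE.
rewrite hornerD hornerZ p_root add0r horner_sum (bigD1 l) //=.
rewrite big1 ?hornerZ ?addr0 // => m ml.
by rewrite hornerZ w_root ?mulr0.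
Qed.

Definition pivot q l := (w q l).[x q l] * \prod_(i | i != q) (p i).[x q l].

(** At [e = 0] all rows except row [q] are diagonal. *)
Lemma det_reduced_mx0 q l u : \det (reduced_mx q l 0 u) = pivot q l * u q l.
Proof.
rewrite (@det_diag_but_row _ _ _ q) => [|i j iq ij]; last first.
  by rewrite mxE (negbTE iq) (negbTE ij) mul0r.
rewrite (bigD1 q) //= mxE eqxx (eq_bigr (fun i => (p i).[x q l])) => [|i iq].
  by rewrite /pivot; ring.
by rewrite mxE (negbTE iq) eqxx mul0r addr0.
Qed.

Lemma small_pert_det_reduced_mx q l :
  small_pert (fun e u => \det (reduced_mx q l e u)).
Proof.
apply: small_pert_det => i j.
pose F e (u : 'M[R]_(n, k)) :=
    if i == q then
      if j == q then u q l * (w q l).[x q l] else (c q j).[x q l]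
    else if i == j then (p i).[x q l] + e * \sum_m u i m * (w i m).[x q l]
    else e * (c i j).[x q l].
apply: (@eq_small_pert _ _ F) => [e u|]; first by rewrite mxE.
rewrite /F; case: (i == q); case: (_ == _).
- by apply: small_pertM; [exact: small_pert_entry|exact: small_pert_cst].
- exact: small_pert_cst.
- apply: small_pertD; first exact: small_pert_cst.
  apply: small_pertM; first exact: small_pert_param.
  apply: small_pert_sum => m _.
  by apply: small_pertM; [exact: small_pert_entry|exact: small_pert_cst].
- by apply: small_pertM; [exact: small_pert_param|exact: small_pert_cst].
Qed.

Lemma exists_pert_mx_roots : (forall q l, pivot q l != 0) ->
  exists2 e : R, 0 < e &
    exists u : 'M[R]_(n, k), forall q l, root (\det (pert_mx e u)) (x q l).
Proof.
move=> piv0.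
have /choice [h hP] : forall ql : 'I_n * 'I_k,
    exists h : R -> 'M[R]_(n, k) -> R,
    unif_lip h /\ forall e u, \det (reduced_mx ql.1 ql.2 e u) =
      pivot ql.1 ql.2 * (u ql.1 ql.2 - e * h e u).
  move=> [q l] /=; have [h [lh _ hE]] := small_pert_det_reduced_mx q l.
  (* Dividing the remainder by minus the pivot turns the vanishing of the determinant into
     [u q l = e * h e u]. *)
  exists (fun e u => - (pivot q l)^-1 * h e u); split.
    by apply: unif_lipM => //; apply: (unif_lip_cst (C := `|- (pivot q l)^-1|)).
  move=> e u; rewrite hE det_reduced_mx0; field; exact: piv0.
have [|e e0 [u uE]] := @small_param_fixpoint R n k (fun q l => h (q, l)).
  by move=> q l; case: (hP (q, l)).
exists e => //; exists u => q l.
rewrite rootE -horner_evalE -det_map_mx horner_pert_mx det_mulmx.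
by have [_ ->] := hP (q, l); rewrite /= -uE subrr !mulr0.
Qed.

End PrescribedRoots.

(** * Construction of the matrix polynomial from the prescribed data *)

Theorem theorem5p2 (R : realType) (n k : nat) (hn : (1 <= n)%N)
    (hk : (1 <= k)%N)
    (lambda : 'I_(n * k) -> R) (hlambda : injective lambda)
    (alpha : 'I_n -> R) (halpha : forall i : 'I_n, 0 < alpha i)
    (G : 'I_k -> rel 'I_n) (hG : forall s : 'I_k, simple_graph (G s)) :
  exists A : 'I_k.+1 -> 'M[R]_n,
    [/\ forall s : 'I_k.+1, (A s)^T = A s,
        forall z : R[i],
          proper_value A z <-> exists i : 'I_(n * k), z = (lambda i)%:C,
        A ord_max = diag_mx (\row_(i < n) alpha i)
      & forall s : 'I_k, mx_graph (A (widen_ord (leqnSn k) s)) =2 G s].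
Proof.
(* The bijection [mxvec_index] between pairs and ['I_(n * k)] splits the values into [n] groups of
   [k]. *)
pose x (q : 'I_n) (l : 'I_k) : R := lambda (mxvec_index q l).
have x_inj q l i m : x q l = x i m -> q = i /\ l = m.
  move=> /hlambda; case: (curry_mxvec_bij n k) => g gK _ eq_ix.
  by have := congr1 g eq_ix; rewrite !(gK (_, _)) // => -[].
pose p i := alpha i *: \prod_(m <- enum 'I_k) ('X - (x i m)%:P).
pose w i m := \prod_(m' | m' != m) ('X - (x i m')%:P).
(* The coefficients are adjacency bits; [insub] turns [s < k] back into an ordinal, so the default 0
   is never reached. *)
pose c i j := \poly_(s < k) if insub s is Some s' then (G s' i j)%:R else 0 : R.
have size_p i : size (p i) = k.+1.
  by rewrite size_scale ?gt_eqF // size_prod_XsubC size_enum_ord.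
have size_w i m : (size (w i m) <= k)%N.
  apply: leq_trans (size_poly_prod_leq _ _) _.
  rewrite (eq_bigr (fun=> 2%N)) => [|m' _]; last by rewrite size_XsubC.
  rewrite sum_nat_const (eq_card (B := predC1 m)) //.
  by rewrite cardC1 card_ord muln2 -addnn -addSn addnK prednK.
(* The equivalence serves twice: the case [i = q] gives the root hypothesis, the others make the
   pivots nonzero. *)
have p_root q l i : ((p i).[x q l] == 0) = (i == q).
  rewrite hornerZ mulf_eq0 gt_eqF //= horner_prod prodf_seq_eq0.
  apply/hasP/eqP => [[m _ /=]|->].
    by rewrite !hornerE subr_eq0 => /eqP /x_inj [].
  by exists l; rewrite ?mem_enum //= !hornerE subrr.
have w_root q l m : ((w q m).[x q l] == 0) = (m != l).
  rewrite horner_prod; apply/prodf_eq0/idP => [[m' m'm]|ml].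
    by rewrite !hornerE subr_eq0 => /eqP /x_inj [_ ->]; rewrite eq_sym.
  by exists l; rewrite ?hornerE ?subrr // eq_sym.
have [|||e e0 [u uP]] := @exists_pert_mx_roots R n k p w c x.
- by move=> q l; apply/eqP; rewrite p_root.
- by move=> q l m ml; apply/eqP; rewrite w_root.
- move=> q l; rewrite mulf_neq0 ?w_root ?negbK //.
  by apply/prodf_neq0 => i; rewrite p_root.
pose P := pert_mx p w c e u.
(* The diagonal perturbation has degree below [k], so it leaves the leading coefficient [alpha i]
   intact. *)
have size_d i : (size (e *: \sum_m u i m *: w i m) <= k)%N.
  apply: leq_trans (size_scale_leq _ _) _.
  apply: leq_trans (size_sum _ _ _) _; apply/bigmax_leqP => m _.
  exact: leq_trans (size_scale_leq _ _) (size_w _ _).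
have size_Pd i : size (P i i) = k.+1.
  by rewrite mxE eqxx size_polyDl size_p ?ltnS ?size_d.
have size_Po i j : i != j -> (size (P i j) <= k)%N.
  move=> ij; rewrite mxE (negbTE ij).
  exact: leq_trans (size_scale_leq _ _) (size_poly _ _).
have size_P i j : (size (P i j) <= k.+1)%N.
  by have [->|/size_Po/leqW //] := eqVneq i j; rewrite size_Pd.
exists (fun s => \matrix_(i, j) (P i j)`_s); split.
- move=> s; apply/matrixP => i j; rewrite !mxE.
  have [->//|ij] := eqVneq i j; rewrite !coefZ !coef_poly; case: ifP => // _.
  by case: insubP => // s' _ _; rewrite (hG s').1.
- move=> z; apply: (iff_trans (proper_value_coef _ size_P)).
  (* The determinant has degree [n * k] and the [n * k] distinct values of [lambda] as roots, so
     these are all its complex roots. *)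
  rewrite (@root_map_prod _ _ _ _ (codom lambda)); last 3 first.
  + by rewrite (size_det_diag_dominant size_Pd size_Po) size_codom card_ord.
  + apply/allP => _ /codomP [i ->]; case/mxvec_indexP: i => q l.
    exact: uP.
  + by rewrite map_inj_uniq ?enum_uniq.
  split=> [/mapP [_ /codomP [i ->] ->]|[i ->]]; first by exists i.
  by apply: map_f; exact: codom_f.
- apply/matrixP => i j; rewrite !mxE; have [eij|ij] := eqVneq i j.
    rewrite mulr1n coefD [X in _ + X]nth_default // addr0.
    rewrite coefZ.
    have /monicP := monic_prod_XsubC (enum 'I_k) xpredT (x i).
    by rewrite lead_coefE size_prod_XsubC size_enum_ord => ->; rewrite mulr1.
  by rewrite coefZ coef_poly ltnn mulr0.
move=> s i j; rewrite /mx_graph !mxE; have [eij|ij] := eqVneq i j.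
  by rewrite eij (hG s).2.
(* Off the diagonal the coefficient is [e] times the adjacency bit, and [e] is nonzero. *)
rewrite coefZ coef_poly /= ltn_ord valK mulf_eq0 gt_eqF //.
by case: (G s i j); rewrite ?oner_eq0 ?eqxx.
Qed.
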